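(* Consider the two-segment ($m=2$) min-max-energy platooning problem with arbitrary $n$ and identical vehicle parameters, $C_j=C$, $\delta_j=\delta$, $S_{j1}=S$, $\beta_j=\beta$ for all $j$: choose two permutations $(1_1,\ldots,n_1)$ and $(1_2,\ldots,n_2)$ of $(1,\ldots,n)$ to minimize $\max_{1\le j\le n}\delta\,[D_1(1-\eta_{j_1})+D_2(1-\eta_{j_2})]$ subject to $S-\frac{\delta}{C}[D_1(1-\eta_{j_1})+D_2(1-\eta_{j_2})]\ge\beta$ for all $j$. Rule 3 solves this problem in $O(n)$ time, either by finding an optimal solution or verifying that the problem is infeasible.
   Context: Setting. There are $n$ vehicles and two road segments of lengths $D_1,D_2>0$. All vehicles have battery capacity $C>0$, usage rate $\delta>0$, initial state of charge $S\in[0,1]$, and minimum allowable final state of charge $\beta$ with $0\le\beta<S$. Platoon positions have usage-rate reductions $0\le\eta_1\le\cdots\le\eta_n<1$. In a solution, $j_i$ denotes the position of vehicle $j$ in segment $i$ (for each $i$, $j\mapsto j_i$ is a permutation of $\{1,\ldots,n\}$). Vehicle $j$ uses energy $\delta\sum_{i=1}^2D_i(1-\eta_{j_i})$, and its final state of charge is $S$ minus this quantity divided by $C$. A solution is feasible if each vehicle's final state of charge is at least $\beta$; the problem is infeasible if no feasible solution exists. Rule 3: Assign vehicle $j$ to position $j$ in segment 1 and to position $n-j+1$ in segment 2, for $j=1,\ldots,n$. (If this assignment is not feasible, infeasibility is reported.) Running time counts elementary arithmetic operations and comparisons. *)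

(* Defs.v *)
From HB Require Import structures.
From mathcomp Require Import all_boot all_order all_algebra all_fingroup.

Set Implicit Arguments.
Unset Strict Implicit.
Unset Printing Implicit Defensive.

Import Order.TTheory GRing.Theory Num.Theory.

(* Vehicles and positions are numbered from 0 and both indexed by 'I_n.       *)

Section Platooning.
Local Open Scope ring_scope.

Record instance (R : realFieldType) (n : nat) := Instance {
  len1 : R;
  len2 : R;
  capacity : R;
  rate : R;
  soc0 : R;
  min_soc : R;
  eta : 'I_n -> R }.

Variables (R : realFieldType) (n : nat) (I : instance R n).

Record well_posed : Prop := WellPosed {
  len1_gt0 : 0 < len1 I;
  len2_gt0 : 0 < len2 I;
  capacity_gt0 : 0 < capacity I;
  rate_gt0 : 0 < rate I;
  soc0_bounds : 0 <= soc0 I <= 1;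
  min_soc_bounds : 0 <= min_soc I < soc0 I;
  eta_bounds : forall i, 0 <= eta I i < 1;
  eta_mono : forall i j : 'I_n, (i <= j)%N -> eta I i <= eta I j }.

(* s.1 j and s.2 j are the positions of vehicle j in segments 1 and 2.        *)
Definition solution := ({perm 'I_n} * {perm 'I_n})%type.

Definition energy (s : solution) (j : 'I_n) : R :=
  rate I * (len1 I * (1 - eta I (s.1 j)) + len2 I * (1 - eta I (s.2 j))).

Definition final_soc (s : solution) (j : 'I_n) : R :=
  soc0 I - energy s j / capacity I.

Definition feasible (s : solution) : Prop :=
  forall j, min_soc I <= final_soc s j.

(* The default value 0 of the maximum is harmless: well_posed makes every     *)
(* energy positive.                                                           *)
Definition max_energy (s : solution) : R :=
  \big[Num.max/0]_(j < n) energy s j.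

Definition optimal (s : solution) : Prop :=
  feasible s /\ forall s', feasible s' -> max_energy s <= max_energy s'.

Definition infeasible : Prop := ~ exists s, feasible s.

Definition rule3_solution : solution := (1%g, perm (@rev_ord_inj n)).

End Platooning.

(* A random-access machine with unbounded registers and arrays, holding       *)
(* either natural numbers (indices, positions) or elements of R, programmed   *)
(* with straight-line code, tests and counted loops.  Programs depend neither *)
(* on R nor on the size of the input, and contain no constant of R other than *)
(* the images of natural numbers.                                             *)

Inductive nexp :=
  | NConst of nat
  | NReg of nat
  | NGet of nat & nexp
  | NAdd of nexp & nexp
  | NSub of nexp & nexp.

Inductive rexp :=
  | RConst of nat
  | RReg of nat
  | RGet of nat & nexp
  | RAdd of rexp & rexp
  | RSub of rexp & rexp
  | RMul of rexp & rexp
  | RDiv of rexp & rexp.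

Inductive test :=
  | NLe of nexp & nexp
  | RLe of rexp & rexp.

Inductive cmd :=
  | Skip
  | NSet of nat & nexp
  | RSet of nat & rexp
  | NPut of nat & nexp & nexp
  | RPut of nat & nexp & rexp
  | Seq of cmd & cmd
  | If of test & cmd & cmd
  | For of nat & nexp & cmd.

(* Every node of an evaluated expression costs one unit, so the cost is at    *)
(* least the number of arithmetic operations and comparisons performed.       *)

Fixpoint ncost (e : nexp) : nat :=
  match e with
  | NConst _ | NReg _ => 1
  | NGet _ e1 => (ncost e1).+1
  | NAdd e1 e2 | NSub e1 e2 => (ncost e1 + ncost e2).+1
  end.

Fixpoint rcost (e : rexp) : nat :=
  match e with
  | RConst _ | RReg _ => 1
  | RGet _ e1 => (ncost e1).+1
  | RAdd e1 e2 | RSub e1 e2 | RMul e1 e2 | RDiv e1 e2 =>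
      (rcost e1 + rcost e2).+1
  end.

Definition tcost (b : test) : nat :=
  match b with
  | NLe e1 e2 => (ncost e1 + ncost e2).+1
  | RLe e1 e2 => (rcost e1 + rcost e2).+1
  end.

Section Machine.
Variable R : realFieldType.

Record state := State {
  nreg : nat -> nat;
  rreg : nat -> R;
  narr : nat -> nat -> nat;
  rarr : nat -> nat -> R }.

Definition upd (T : Type) (f : nat -> T) (x : nat) (v : T) : nat -> T :=
  fun y => if y == x then v else f y.

Definition set_nreg (st : state) x v :=
  State (upd (nreg st) x v) (rreg st) (narr st) (rarr st).
Definition set_rreg (st : state) x v :=
  State (nreg st) (upd (rreg st) x v) (narr st) (rarr st).
Definition set_narr (st : state) a i v :=
  State (nreg st) (rreg st) (upd (narr st) a (upd (narr st a) i v)) (rarr st).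
Definition set_rarr (st : state) a i v :=
  State (nreg st) (rreg st) (narr st) (upd (rarr st) a (upd (rarr st a) i v)).

Fixpoint neval (st : state) (e : nexp) : nat :=
  match e with
  | NConst k => k
  | NReg x => nreg st x
  | NGet a e1 => narr st a (neval st e1)
  | NAdd e1 e2 => neval st e1 + neval st e2
  | NSub e1 e2 => neval st e1 - neval st e2
  end.

Fixpoint reval (st : state) (e : rexp) : R :=
  match e with
  | RConst k => k%:R
  | RReg x => rreg st x
  | RGet a e1 => rarr st a (neval st e1)
  | RAdd e1 e2 => reval st e1 + reval st e2
  | RSub e1 e2 => reval st e1 - reval st e2
  | RMul e1 e2 => reval st e1 * reval st e2
  | RDiv e1 e2 => reval st e1 / reval st e2
  end%R.

Definition teval (st : state) (b : test) : bool :=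
  match b with
  | NLe e1 e2 => neval st e1 <= neval st e2
  | RLe e1 e2 => (reval st e1 <= reval st e2)%R
  end.

(* exec c st is the final state together with the running time.  The loop     *)
(* For x e c runs c with register x equal to 0, 1, ..., b - 1, where b is the *)
(* value of e on entry; each iteration is charged 2 extra units, for          *)
(* incrementing the counter and testing it against b.                         *)
Fixpoint exec (c : cmd) (st : state) : state * nat :=
  match c with
  | Skip => (st, 1)
  | NSet x e => (set_nreg st x (neval st e), (ncost e).+1)
  | RSet x e => (set_rreg st x (reval st e), (rcost e).+1)
  | NPut a i e =>
      (set_narr st a (neval st i) (neval st e), (ncost i + ncost e).+1)
  | RPut a i e =>
      (set_rarr st a (neval st i) (reval st e), (ncost i + rcost e).+1)
  | Seq c1 c2 =>
      let r1 := exec c1 st in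
      let r2 := exec c2 r1.1 in
      (r2.1, r1.2 + r2.2)
  | If b c1 c2 =>
      let r := exec (if teval st b then c1 else c2) st in
      (r.1, (tcost b + r.2).+1)
  | For x e c1 =>
      iteri (neval st e)
        (fun k r => let r' := exec c1 (set_nreg r.1 x k) in
                    (r'.1, r.2 + r'.2 + 2))
        (st, (ncost e).+2)
  end.

End Machine.

(* Natural registers *)
Definition xN := 0.
Definition xJ := 1.
Definition xOk := 2.
(* Real registers *)
Definition xLen1 := 0.
Definition xLen2 := 1.
Definition xCapacity := 2.
Definition xRate := 3.
Definition xSoc0 := 4.
Definition xMinSoc := 5.
Definition xEnergy := 6.
(* Arrays of natural numbers *)
Definition aPos1 := 0.
Definition aPos2 := 1.
(* Arrays of reals *)
Definition aEta := 0.

Definition rule3_assign : cmd :=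
  For xJ (NReg xN)
    (Seq (NPut aPos1 (NReg xJ) (NReg xJ))
         (NPut aPos2 (NReg xJ)
            (NSub (NReg xN) (NAdd (NReg xJ) (NConst 1))))).

(* The energy of the vehicle in register xJ, for the stored positions.        *)
Definition energy_exp : rexp :=
  let seg x a := RMul (RReg x)
    (RSub (RConst 1) (RGet aEta (NGet a (NReg xJ)))) in
  RMul (RReg xRate) (RAdd (seg xLen1 aPos1) (seg xLen2 aPos2)).

Definition rule3_check : cmd :=
  Seq (NSet xOk (NConst 1))
      (For xJ (NReg xN)
         (Seq (RSet xEnergy energy_exp)
              (If (RLe (RReg xMinSoc)
                       (RSub (RReg xSoc0)
                             (RDiv (RReg xEnergy) (RReg xCapacity))))
                  Skip
                  (NSet xOk (NConst 0))))).

Definition rule3 : cmd := Seq rule3_assign rule3_check.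

Section Input.
Local Open Scope ring_scope.
Variables (R : realFieldType) (n : nat).

Definition load (I : instance R n) : state R :=
  State (upd (fun=> 0%N) xN n)
        (nth 0 [:: len1 I; len2 I; capacity I; rate I; soc0 I; min_soc I])
        (fun _ _ => 0%N)
        (upd (fun _ _ => 0) aEta
           (fun i => if insub i is Some k then eta I k else 0)).

(* The answer read off a final state: two arrays of positions, or None when   *)
(* infeasibility is reported.                                                 *)
Definition answer (st : state R) : option ((nat -> nat) * (nat -> nat)) :=
  if nreg st xOk == 1%N then Some (narr st aPos1, narr st aPos2) else None.

Definition encodes (p : (nat -> nat) * (nat -> nat)) (s : solution n) : Prop :=
  forall j : 'I_n, p.1 j = s.1 j /\ p.2 j = s.2 j.

End Input.

(* Main.v *)
(** If vehicle [j] of Rule 3 occupies positions [j] and [n - 1 - j] (counting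
    from 0), then in any other solution [j + 1] vehicles have a position at
    most [j] in segment 1 and [n - j] vehicles have a position at most
    [n - 1 - j] in segment 2.  As these numbers add up to [n + 1], some vehicle
    belongs to both groups; since the reductions increase with the position,
    it uses at least as much energy as [j] does under Rule 3.  Rule 3 therefore
    minimizes the maximal energy, and it is feasible as soon as some solution
    is, because all vehicles have the same initial charge and capacity. *)
Require Import Defs.
From mathcomp Require Import all_boot all_order all_algebra all_fingroup.
From mathcomp Require Import zify.

Set Implicit Arguments.
Unset Strict Implicit.
Unset Printing Implicit Defensive.

Import Order.TTheory GRing.Theory Num.Theory.

Lemma card_perm_le n (p : {perm 'I_n}) (j : 'I_n) :
  #|[set k | p k <= j]| = j.+1.
Proof.
have -> : [set k | p k <= j] = p @^-1: [set k : 'I_n | k <= j].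
  by apply/setP=> k; rewrite !inE.
rewrite card_preimset -?sum1_card; last exact: perm_inj.
rewrite (eq_bigl (fun k : 'I_n => k < j.+1)); last by move=> k; rewrite !inE.
by rewrite (big_ord_narrow (ltn_ord j)) sum1_card card_ord.
Qed.

Lemma exists_both_le n (p q : {perm 'I_n}) (j : 'I_n) :
  exists k, p k <= j /\ q k <= rev_ord j.
Proof.
have : 0 < #|[set k | p k <= j] :&: [set k | q k <= rev_ord j]|.
  have := cardsUI [set k | p k <= j] [set k | q k <= rev_ord j].
  have := max_card ([set k | p k <= j] :|: [set k | q k <= rev_ord j]).
  by rewrite !card_perm_le card_ord /=; have := ltn_ord j; lia.
by case/card_gt0P=> k; rewrite !inE => /andP[pk qk]; exists k.
Qed.

Section Energy.
Local Open Scope ring_scope.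
Variables (R : realFieldType) (n : nat) (I : instance R n).
Hypothesis wpI : well_posed I.

Lemma energy_anti (s t : solution n) (j k : 'I_n) :
  (s.1 k <= t.1 j)%N -> (s.2 k <= t.2 j)%N -> energy I t j <= energy I s k.
Proof.
case: wpI => D1_gt0 D2_gt0 _ rate_gt0 _ _ _ mono le1 le2.
by rewrite ler_pM2l // lerD // ler_pM2l // lerB // mono.
Qed.

Lemma rule3_energy_dominated (s : solution n) j :
  exists k, energy I (rule3_solution n) j <= energy I s k.
Proof.
have [k [le1 le2]] := exists_both_le s.1 s.2 j.
by exists k; apply: energy_anti; rewrite /= ?perm1 ?permE.
Qed.

Lemma rule3_feasible (s : solution n) :
  feasible I s -> feasible I (rule3_solution n).
Proof.
move=> feas j; have [k le_jk] := rule3_energy_dominated s j.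
apply: (le_trans (feas k)).
by rewrite lerB // ler_pM2r // invr_gt0 capacity_gt0.
Qed.

Lemma rule3_max_energy_le (s : solution n) :
  max_energy I (rule3_solution n) <= max_energy I s.
Proof.
(* Both maxima start from the default 0, so the default on the left is bounded by the right-hand
   maximum. *)
apply: bigmax_le => [|j _]; first exact: bigmax_ge_id.
have [k le_jk] := rule3_energy_dominated s j.
by apply: (le_trans le_jk); apply: le_bigmax.
Qed.

End Energy.

(** Loop rule for both passes of Rule 3. The number of rounds is fixed on entry, [Inv k] describes
    the state before the counter receives [k], and [b] bounds one run of the body without its 2
    units of loop overhead. *)
Lemma exec_for_ind (R : realFieldType) (Inv : nat -> state R -> Prop)
    (x : nat) (e : nexp) (c : cmd) (b : nat) (st : state R) :
    Inv 0 st ->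
    (forall k st', k < neval st e -> Inv k st' ->
       let r := exec c (set_nreg st' x k) in Inv k.+1 r.1 /\ r.2 <= b) ->
  let r := exec (For x e c) st in
  Inv (neval st e) r.1 /\ r.2 <= (ncost e).+2 + neval st e * (b + 2).
Proof.
move=> Inv0 InvS /=; elim: (neval st e) InvS => [|m IHm] InvS /=.
  by rewrite mul0n addn0.
have [k st' lt_km|Invm cost_m] := IHm; first exact/InvS/ltnW.
by have [] := InvS m _ (ltnSn m) Invm; split=> //; lia.
Qed.

Section Rule3.
Variables (R : realFieldType) (n : nat) (I : instance R n).

(** The bound [xEnergy] singles out the six input registers; [xEnergy] itself is scratch space, so
    both loops preserve this property. *)
Definition loaded (st : state R) : Prop :=
  [/\ nreg st xN = n, forall x, x < xEnergy -> rreg st x = rreg (load I) x &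
      rarr st = rarr (load I)].

Definition assigned (m : nat) (st : state R) : Prop :=
  forall j, j < m -> narr st aPos1 j = j /\ narr st aPos2 j = n - (j + 1).

Lemma exec_rule3_assign :
  let r := exec rule3_assign (load I) in
  [/\ loaded r.1, assigned n r.1 & r.2 <= 3 + n * 12].
Proof.
(* The two writes cost 3 and 7, hence 10. *)
have [||[? ?] ?] := @exec_for_ind R (fun m st => loaded st /\ assigned m st)
  xJ (NReg xN) (Seq (NPut aPos1 (NReg xJ) (NReg xJ))
         (NPut aPos2 (NReg xJ)
            (NSub (NReg xN) (NAdd (NReg xJ) (NConst 1))))) 10 (load I).
- by [].
- move=> k st _ [[Nst rst ast] pos] /=; split=> //; split=> // j.
  rewrite ltnS leq_eqVlt /= /upd /= Nst => /orP[/eqP->|lt_jk].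
    by rewrite eqxx.
  by rewrite ltn_eqF //; apply: pos.
- by split.
Qed.


(** What the flag [xOk] must record after [m] rounds of the check; for [m = n] it is feasibility. *)
Definition socs_ok (m : nat) : Prop :=
  forall j : 'I_n, j < m ->
    (min_soc I <= final_soc I (rule3_solution n) j)%R.

Lemma reval_energy_exp (st : state R) (j : 'I_n) :
  loaded st -> assigned n st -> nreg st xJ = j ->
  reval st energy_exp = energy I (rule3_solution n) j.
Proof.
move=> [_ rst ast] pos Jst; have [p1 p2] := pos j (ltn_ord j).
(* An index below [n] makes [insub] succeed, so the padding 0 of the loaded array is not read. *)
have etaE (k : 'I_n) : rarr st aEta k = eta I k by rewrite ast /= /upd /= valK.
rewrite /energy /= Jst p1 p2 !rst //= addn1 etaE -[n - j.+1]/(val (rev_ord j)).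
by rewrite etaE perm1 permE.
Qed.

(** The positions are carried through the loop because the answer is read off the state after the
    check. *)
Lemma exec_rule3_check (st : state R) :
  loaded st -> assigned n st ->
  let r := exec rule3_check st in
  [/\ assigned n r.1, nreg r.1 xOk = 1 <-> socs_ok n & r.2 <= 5 + n * 30].
Proof.
move=> ld pos.
pose Inv m st' := [/\ loaded st', assigned n st' &
                      nreg st' xOk = 1 <-> socs_ok m].
have Nst : nreg st xN = n by case: ld.
(* Storing the energy costs 18 and the conditional at most 10, reached when the test fails, hence
   28. *)
have [||[_ posr okr] costr] := @exec_for_ind R Inv xJ (NReg xN)
  (Seq (RSet xEnergy energy_exp)
       (If (RLe (RReg xMinSoc)
                (RSub (RReg xSoc0) (RDiv (RReg xEnergy) (RReg xCapacity))))
           Skip (NSet xOk (NConst 0)))) 28 (set_nreg st xOk 1).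
- by split.
- move=> k st' /=; rewrite /upd /= Nst => lt_kn [[Nst' rst' ast'] pos' ok'].
  have ld' : loaded (set_nreg st' xJ k) by [].
  have := @reval_energy_exp (set_nreg st' xJ k) (Ordinal lt_kn) ld' pos' erefl.
  rewrite /= => ->; rewrite !rst' //=.
  have okS : socs_ok k.+1 <-> socs_ok k /\
      (min_soc I <= final_soc I (rule3_solution n) (Ordinal lt_kn))%R.
    split=> [ok|[ok okk] j].
      by split=> [j lt_jk|]; apply: ok => //; apply: ltnW.
    rewrite ltnS leq_eqVlt => /orP[/eqP eq_jk|]; last exact: ok.
    by rewrite (_ : j = Ordinal lt_kn) //; apply: val_inj.
  have ld'' v : loaded (set_rreg (set_nreg st' xJ k) xEnergy v).
    by split=> // x lt_x; rewrite /= /upd ltn_eqF // rst'.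
  (* A passed test leaves the flag as it was; a failed one sets it to 0, and [socs_ok k.+1] is then
     false. *)
  case: ifP => [okk|nokk]; split=> //=; split=> //=.
  - by rewrite /upd /= ok' okS; split=> [|[]].
  - by have [] := ld'' (energy I (rule3_solution n) (Ordinal lt_kn)).
  - by rewrite okS /final_soc nokk; split=> [|[]].
split=> //=; first by move: okr; rewrite /= /upd /= Nst.
by move: costr; rewrite /= /upd /= Nst; lia.
Qed.

End Rule3.

Theorem proposition13 :
  exists K : nat,
  forall (R : realFieldType) (n : nat) (I : instance R n),
    0 < n -> well_posed I ->
    let r := exec rule3 (load I) in
    r.2 <= K * n /\
    match answer r.1 with
    | Some p =>
        exists s : solution n,
          encodes p s /\ s = rule3_solution n /\ optimal I s
    | None => infeasible I
    end.
Proof.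
(* The two passes cost at most [8 + 42 * n], and [n > 0] absorbs the 8. *)
exists 50 => R n I n_gt0 wpI r.
have [ld pos cost1] := exec_rule3_assign I.
have [pos' ok cost2] := exec_rule3_check ld pos.
split.
  rewrite (_ : r.2 = (exec rule3_assign (load I)).2 + (exec rule3_check
    (exec rule3_assign (load I)).1).2) //.
  by apply: leq_trans (leq_add cost1 cost2) _; lia.
have {ok} ok : nreg r.1 xOk = 1 <-> feasible I (rule3_solution n).
  by split=> [/ok h j|h]; [apply: h | apply/ok => j _].
rewrite /answer; case: eqP => [/ok feas|nok].
  exists (rule3_solution n); split; last first.
    by split=> //; split=> // s' _; apply: rule3_max_energy_le.
  move=> j; have [p1 p2] := pos' j (ltn_ord j).
  by split; [rewrite perm1 | rewrite permE [RHS]/= -addn1].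
by case=> s feas; apply/nok/ok/(rule3_feasible wpI feas).
Qed.
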